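(* Let $(X_1,\triangleright)$ and $(X_2,\triangleright)$ be quandles with finitely many connected components and such that the natural maps $X_i\to G_{X_i}$ to their enveloping groups are injective for $i=1,2$. Then every connected component of the free product $X_1*X_2$ has infinite diameter with respect to the rack metric.
   Context: A quandle is a non-empty set $X$ with a binary operation $\triangleright$ such that for every $x\in X$ the map $\psi_x(y)=x\triangleright y$ is a bijection of $X$, $x\triangleright(y\triangleright z)=(x\triangleright y)\triangleright(x\triangleright z)$ for all $x,y,z$, and $x\triangleright x=x$ for all $x$. The connected components are the orbits of the group generated by all $\psi_x$. The rack metric on a connected component is $d(x,y)=\min\{n\in\mathbb N\mid y=(\psi_{x_1}^{\pm1}\circ\dots\circ\psi_{x_n}^{\pm1})(x)\text{ for some elements }x_i\text{ of the quandle}\}$ ($n=0$ allowed). The enveloping group of $X$ is $G_X=\langle X\mid x\triangleright y=xyx^{-1},\ x,y\in X\rangle$, and the natural map $X\to G_X$ sends $x$ to the generator $x$. The free product $X_1*X_2$ of quandles is their coproduct in the category of quandles (equivalently, if $X_i$ is given by a quandle presentation, $X_1*X_2$ is presented by the disjoint union of the generators and of the relations). *)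

(* Defs.v *)
From HB Require Import structures.
From mathcomp Require Import all_boot.
From mathcomp Require Import boolp classical_sets cardinality.

Set Implicit Arguments.
Unset Strict Implicit.
Unset Printing Implicit Defensive.

Local Open Scope classical_set_scope.
Local Open Scope quotient_scope.

HB.mixin Record isQuandle (X : Type) := {
  qop : X -> X -> X;
  quandle_inhabited : inhabited X;
  qop_bij : forall x, bijective (qop x);
  qopD : forall x y z, qop x (qop y z) = qop (qop x y) (qop x z);
  qopxx : forall x, qop x x = x
}.

#[short(type="quandleType")]
HB.structure Definition Quandle := {X of isQuandle X}.

Declare Scope quandle_scope.
Delimit Scope quandle_scope with Q.
Notation "x ▷ y" := (qop x y) (at level 40, left associativity) : quandle_scope.
Local Open Scope quandle_scope.

Section InnerGroup.
Variable X : quandleType.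
Implicit Types (x y : X) (f g : X -> X).

Lemma qop_surj x y : exists z, x ▷ z = y.
Proof. by have [g _ gK] := @qop_bij X x; exists (g y). Qed.

Definition qdiv x y : X := sval (cid (qop_surj x y)).

Lemma qdivK x : cancel (qdiv x) (qop x).
Proof. by move=> y; rewrite /qdiv; case: cid. Qed.

Lemma qopK x : cancel (qop x) (qdiv x).
Proof. by move=> y; apply: (bij_inj (@qop_bij X x)); rewrite qdivK. Qed.

(* psi (x, true) is the left translation by x, psi (x, false) its inverse *)
Definition psi (p : X * bool) : X -> X :=
  if p.2 then qop p.1 else qdiv p.1.

Inductive inner_group : set (X -> X) :=
| inner_id : inner_group id
| inner_gen x : inner_group (qop x)
| inner_inv f g of inner_group f & cancel f g & cancel g f : inner_group g
| inner_comp f g of inner_group f & inner_group g : inner_group (f \o g).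

Definition component x : set X := [set y | exists2 g, inner_group g & y = g x].

Definition components : set (set X) := range component.

(* act [:: p_1; ...; p_n] = psi p_1 \o ... \o psi p_n *)
Definition act (s : seq (X * bool)) : X -> X := foldr (fun p f => psi p \o f) id s.

Definition rack_reach x y (n : nat) : Prop :=
  exists s : seq (X * bool), size s = n /\ y = act s x.

(* The value 0 is only a default when x and y are in distinct components. *)
Definition rack_dist x y : nat :=
  match pselect (exists n, `[< rack_reach x y n >]) with
  | left h => ex_minn h
  | right _ => 0
  end.

Definition infinite_diameter (C : set X) : Prop :=
  forall N : nat, exists x y, [/\ C x, C y & N <= rack_dist x y].

Lemma act_cat s t x : act (s ++ t) x = act s (act t x).
Proof. by elim: s => //= p s IH; rewrite IH. Qed.

Definition negw (s : seq (X * bool)) := rev [seq (p.1, ~~ p.2) | p <- s].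

Lemma act_negw s : cancel (act s) (act (negw s)).
Proof.
elim: s => [|[x b] s IH] y //=.
rewrite /negw /= rev_cons -cats1 act_cat /=.
by case: b; rewrite /psi /= ?qopK ?qdivK; apply: IH.
Qed.

Lemma inner_groupP g : inner_group g <-> exists s, g = act s.
Proof.
split.
- elim=> {g} [|x|f g _ [s ->] fK gK|f g _ [s ->] _ [t ->]].
  + by exists [::].
  + by exists [:: (x, true)].
  + by exists (negw s); apply/funext => x; rewrite -{2}[x]gK act_negw.
  + by exists (s ++ t); apply/funext => x; rewrite act_cat.
- case=> s ->; elim: s => [|[x b] s IH]; first exact: inner_id.
  apply: inner_comp => //; case: b; first exact: inner_gen.
  by apply: inner_inv (inner_gen x) _ _; [apply: qopK | apply: qdivK].
Qed.

Lemma componentP x y : component x y <-> exists n, rack_reach x y n.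
Proof.
split=> [[g /inner_groupP[s ->] ->]|[n [s [_ ->]]]].
  by exists (size s), s.
by exists (act s) => //; apply/inner_groupP; exists s.
Qed.

Lemma rack_distP x y : component x y ->
  rack_reach x y (rack_dist x y) /\
  (forall n, rack_reach x y n -> rack_dist x y <= n).
Proof.
move=> /componentP xy; rewrite /rack_dist; case: pselect => [h|[]].
  case: ex_minnP => m /asboolP xym mP; split=> // n xyn.
  by apply: mP; apply/asboolP.
by case: xy => n xyn; exists n; apply/asboolP.
Qed.

End InnerGroup.

Arguments components X : clear implicits.
Arguments inner_group X : clear implicits.

(* (x, true) stands for the generator x and (x, false) for its formal inverse *)
Definition env_word (X : quandleType) : Type := seq (X * bool).

HB.instance Definition _ (X : quandleType) := gen_eqMixin (env_word X).
HB.instance Definition _ (X : quandleType) := gen_choiceMixin (env_word X).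

Section EnvelopingGroup.
Variable X : quandleType.
Implicit Types u v w : env_word X.

Inductive env_eq : env_word X -> env_word X -> Prop :=
| env_refl u : env_eq u u
| env_sym u v of env_eq u v : env_eq v u
| env_trans u v w of env_eq u v & env_eq v w : env_eq u w
| env_cat u u' v v' of env_eq u u' & env_eq v v' : env_eq (u ++ v) (u' ++ v')
| env_inv x b : env_eq [:: (x, b); (x, ~~ b)] [::]
| env_rel x y :
    env_eq [:: (x ▷ y, true)] [:: (x, true); (y, true); (x, false)].

Definition env_eqb : rel (env_word X) := fun u v => `[< env_eq u v >].

Lemma env_eqb_refl : reflexive env_eqb.
Proof. by move=> u; apply/asboolP; apply: env_refl. Qed.

Lemma env_eqb_sym : symmetric env_eqb.
Proof. by move=> u v; apply/asboolP/asboolP; apply: env_sym. Qed.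

Lemma env_eqb_trans : transitive env_eqb.
Proof.
by move=> v u w /asboolP uv /asboolP vw; apply/asboolP; apply: env_trans uv vw.
Qed.

Canonical env_equiv := EquivRel env_eqb env_eqb_refl env_eqb_sym env_eqb_trans.

Definition enveloping : Type := {eq_quot env_equiv}.
HB.instance Definition _ := Choice.on enveloping.
HB.instance Definition _ := EqQuotient.on enveloping.

Lemma env_piP u v : (\pi_enveloping u = \pi_enveloping v) <-> env_eq u v.
Proof. by split=> [/eqmodP/asboolP|uv]; last by apply/eqmodP/asboolP. Qed.

Lemma env_reprP u : env_eq (repr (\pi_enveloping u)) u.
Proof. by apply/env_piP; rewrite reprK. Qed.

Lemma env_negw u v : env_eq u v -> env_eq (negw u) (negw v).
Proof.
elim=> {u v}.
- by move=> u; apply: env_refl.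
- by move=> u v _; apply: env_sym.
- by move=> u v w _ uv _; apply: env_trans uv.
- move=> u u' v v' _ uu' _ vv'.
  by rewrite /negw !map_cat !rev_cat; apply: env_cat.
- by move=> x b; rewrite /negw /= negbK; apply: env_inv.
- move=> x y; rewrite /negw /=.
  pose a := [:: (x ▷ y, false)]; pose c := [:: (x, true); (y, false); (x, false)].
  pose r := [:: (x, true); (y, true); (x, false)].
  have rc : env_eq (r ++ c) [::].
    apply: (env_trans (v := [:: (x, true)] ++ ([::] ++ [:: (x, false)])));
      last exact: (env_inv x true).
    apply: (env_trans (v := [:: (x, true); (y, true)] ++
                            ([::] ++ [:: (y, false); (x, false)]))).
      exact: (env_cat (env_refl [:: (x, true); (y, true)])
               (env_cat (env_inv x false) (env_refl [:: (y, false); (x, false)]))).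
    exact: (env_cat (env_refl [:: (x, true)])
               (env_cat (env_inv y true) (env_refl [:: (x, false)]))).
  apply: (env_trans (v := a ++ (r ++ c))).
    exact: env_sym (env_cat (env_refl a) rc).
  apply: (env_trans (v := (a ++ [:: (x ▷ y, true)]) ++ c)).
    rewrite -catA; apply: env_cat; first exact: env_refl.
    by apply: env_cat; [apply: env_sym; apply: env_rel | apply: env_refl].
  exact: (env_cat (env_inv (x ▷ y) false) (env_refl c)).
Qed.

Lemma env_mulVw u : env_eq (negw u ++ u) [::].
Proof.
elim: u => [|[x b] u IH]; first exact: env_refl.
rewrite /negw /= rev_cons -cats1 -catA /=.
apply: env_trans IH; apply: env_cat; first exact: env_refl.
have := env_inv x (~~ b); rewrite negbK => xb.
exact: (env_cat xb (env_refl u)).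
Qed.

Lemma negwK u : negw (negw u) = u.
Proof.
rewrite /negw map_rev revK -map_comp.
by elim: u => //= -[x b] u -> /=; rewrite negbK.
Qed.

Definition env_one : enveloping := \pi_enveloping [::].
Definition env_mul (a b : enveloping) : enveloping :=
  \pi_enveloping (repr a ++ repr b).
Definition env_invg (a : enveloping) : enveloping := \pi_enveloping (negw (repr a)).

Lemma env_mulE u v :
  env_mul (\pi_enveloping u) (\pi_enveloping v) = \pi_enveloping (u ++ v).
Proof. by apply/env_piP; apply: env_cat; apply: env_reprP. Qed.

Lemma env_invgE u : env_invg (\pi_enveloping u) = \pi_enveloping (negw u).
Proof. by apply/env_piP; apply: env_negw; apply: env_reprP. Qed.

Lemma env_mulA : associative env_mul.
Proof.
elim/quotW=> u; elim/quotW=> v; elim/quotW=> w.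
by rewrite (env_mulE u v) (env_mulE v w) (env_mulE u) (env_mulE _ w) catA.
Qed.

Lemma env_mul1 : left_id env_one env_mul.
Proof. by move=> a; rewrite -[a]reprK env_mulE. Qed.

Lemma env_mulr1 : right_id env_one env_mul.
Proof. by move=> a; rewrite -[a]reprK env_mulE cats0. Qed.

Lemma env_mulV : left_inverse env_one env_invg env_mul.
Proof.
move=> a; rewrite -[a]reprK env_invgE env_mulE; apply/env_piP; exact: env_mulVw.
Qed.

Lemma env_mulrV : right_inverse env_one env_invg env_mul.
Proof.
move=> a; rewrite -[a]reprK env_invgE env_mulE; apply/env_piP.
by rewrite -{1}[repr a]negwK; apply: env_mulVw.
Qed.

HB.instance Definition _ :=
  isGroup.Build enveloping env_mulA env_mul1 env_mulr1 env_mulV env_mulrV.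

Definition env_gen (x : X) : enveloping := \pi_enveloping [:: (x, true)].

Local Open Scope group_scope.

Lemma env_genV x : (env_gen x)^-1 = \pi_enveloping [:: (x, false)].
Proof. exact: env_invgE. Qed.

Lemma env_gen_op x y :
  env_gen (x ▷ y)%Q = env_gen x * env_gen y * (env_gen x)^-1.
Proof.
rewrite env_genV [X in X * _](env_mulE [:: (x, true)] [:: (y, true)]).
rewrite [RHS](env_mulE _ [:: (x, false)]); apply/env_piP; exact: env_rel.
Qed.

End EnvelopingGroup.

Arguments env_gen X x : clear implicits.

Lemma env_universal (X : quandleType) (G : groupType) (f : X -> G) :
  (forall x y, f (x ▷ y)%Q = f x * f y * (f x)^-1)%g ->
  exists! h : enveloping X -> G,
    {morph h : a b / (a * b)%g >-> (a * b)%g} /\ forall x, h (env_gen X x) = f x.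
Proof.
move=> fM.
pose ev (u : env_word X) : G :=
  foldr (fun p a => ((if p.2 then f p.1 else (f p.1)^-1) * a)%g) 1%g u.
have ev_cat u v : ev (u ++ v) = (ev u * ev v)%g.
  by elim: u => [|p u IH] /=; rewrite ?mul1g // IH mulgA.
have evP u v : env_eq u v -> ev u = ev v.
  elim=> {u v} //=.
  - by move=> u v w _ -> _ ->.
  - by move=> u u' v v' _ uu' _ vv'; rewrite !ev_cat uu' vv'.
  - by move=> x [] /=; rewrite mulg1 ?mulgV ?mulVg.
  - by move=> x y; rewrite !mulg1 fM mulgA.
have piE u : ev (repr (\pi_(enveloping X) u)) = ev u.
  by apply: evP; apply: env_reprP.
exists (fun a => ev (repr a)); split; first split.
- by move=> a b; rewrite -ev_cat -[RHS]piE.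
- by move=> x; rewrite piE /= mulg1.
- move=> h [hM hf]; apply/funext => a.
  have h1 : h 1%g = 1%g by apply: (mulgI (h 1%g)); rewrite -hM !mulg1.
  rewrite -{2}[a]reprK; elim: (repr a) => [|[x b] u IH] /=; first by rewrite h1.
  have -> : \pi_(enveloping X) ((x, b) :: u) =
      (\pi_(enveloping X) [:: (x, b)] * \pi_(enveloping X) u)%g.
    by rewrite [RHS]env_mulE.
  rewrite hM -IH; congr (_ * _)%g; case: b => /=; first by rewrite -hf.
  rewrite -env_genV -hf; apply: (mulgI (h (env_gen X x))).
  by rewrite -hM !mulgV h1.
Qed.

Definition quandle_hom (X Y : quandleType) (f : X -> Y) : Prop :=
  {morph f : x y / x ▷ y}.

Definition is_free_product (X1 X2 P : quandleType)
    (i1 : X1 -> P) (i2 : X2 -> P) : Prop :=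
  [/\ quandle_hom i1, quandle_hom i2 &
    forall (Y : quandleType) (f1 : X1 -> Y) (f2 : X2 -> Y),
      quandle_hom f1 -> quandle_hom f2 ->
      exists! f : P -> Y, [/\ quandle_hom f, f \o i1 =1 f1 & f \o i2 =1 f2]].

Lemma quandle_hom_div (X Y : quandleType) (f : X -> Y) :
  quandle_hom f -> {morph f : x y / qdiv x y}.
Proof.
by move=> fM x y; apply: (bij_inj (@qop_bij Y (f x))); rewrite -fM !qdivK.
Qed.

Section FreeProduct.
Variables X1 X2 : quandleType.

Inductive fp_term : Type :=
| FP1 of X1
| FP2 of X2
| FPop of fp_term & fp_term
| FPdiv of fp_term & fp_term.

HB.instance Definition _ := gen_eqMixin fp_term.
HB.instance Definition _ := gen_choiceMixin fp_term.

Inductive fp_eq : fp_term -> fp_term -> Prop :=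
| fp_refl t : fp_eq t t
| fp_sym s t of fp_eq s t : fp_eq t s
| fp_trans s t u of fp_eq s t & fp_eq t u : fp_eq s u
| fp_op s s' t t' of fp_eq s s' & fp_eq t t' : fp_eq (FPop s t) (FPop s' t')
| fp_div s s' t t' of fp_eq s s' & fp_eq t t' : fp_eq (FPdiv s t) (FPdiv s' t')
| fp_opK s t : fp_eq (FPdiv s (FPop s t)) t
| fp_divK s t : fp_eq (FPop s (FPdiv s t)) t
| fp_opD s t u : fp_eq (FPop s (FPop t u)) (FPop (FPop s t) (FPop s u))
| fp_opxx t : fp_eq (FPop t t) t
| fp_rel1 x y : fp_eq (FP1 (x ▷ y)) (FPop (FP1 x) (FP1 y))
| fp_rel2 x y : fp_eq (FP2 (x ▷ y)) (FPop (FP2 x) (FP2 y)).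

Definition fp_eqb : rel fp_term := fun s t => `[< fp_eq s t >].

Lemma fp_eqb_refl : reflexive fp_eqb.
Proof. by move=> u; apply/asboolP; apply: fp_refl. Qed.

Lemma fp_eqb_sym : symmetric fp_eqb.
Proof. by move=> u v; apply/asboolP/asboolP; apply: fp_sym. Qed.

Lemma fp_eqb_trans : transitive fp_eqb.
Proof.
by move=> v u w /asboolP uv /asboolP vw; apply/asboolP; apply: fp_trans uv vw.
Qed.

Canonical fp_equiv := EquivRel fp_eqb fp_eqb_refl fp_eqb_sym fp_eqb_trans.

Definition free_product : Type := {eq_quot fp_equiv}.
HB.instance Definition _ := EqQuotient.on free_product.

Lemma fp_piP s t : (\pi_free_product s = \pi_free_product t) <-> fp_eq s t.
Proof. by split=> [/eqmodP/asboolP|st]; last by apply/eqmodP/asboolP. Qed.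

Lemma fp_reprP t : fp_eq (repr (\pi_free_product t)) t.
Proof. by apply/fp_piP; rewrite reprK. Qed.

Definition fp_qop (a b : free_product) : free_product :=
  \pi_free_product (FPop (repr a) (repr b)).

Lemma fp_qopE s t : fp_qop (\pi_free_product s) (\pi_free_product t) =
  \pi_free_product (FPop s t).
Proof. by apply/fp_piP; apply: fp_op; apply: fp_reprP. Qed.

Lemma fp_inhabited : inhabited free_product.
Proof. by have [x] := @quandle_inhabited X1; exists; exact: (\pi_free_product (FP1 x)). Qed.

Lemma fp_qop_bij a : bijective (fp_qop a).
Proof.
exists (fun b => \pi_free_product (FPdiv (repr a) (repr b))) => b;
  rewrite -[RHS]reprK; apply/fp_piP.
- apply: fp_trans (fp_opK (repr a) _).
  by apply: fp_div; [apply: fp_refl | apply: fp_reprP].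
- apply: fp_trans (fp_divK (repr a) _).
  by apply: fp_op; [apply: fp_refl | apply: fp_reprP].
Qed.

Lemma fp_qopD a b c : fp_qop a (fp_qop b c) = fp_qop (fp_qop a b) (fp_qop a c).
Proof.
elim/quotW: a => s; elim/quotW: b => t; elim/quotW: c => u.
rewrite (fp_qopE t u) (fp_qopE s t) (fp_qopE s u) (fp_qopE s) (fp_qopE _ (FPop s u)).
apply/fp_piP; exact: fp_opD.
Qed.

Lemma fp_qopxx a : fp_qop a a = a.
Proof. by rewrite -[a]reprK fp_qopE; apply/fp_piP; apply: fp_opxx. Qed.

HB.instance Definition _ :=
  isQuandle.Build free_product fp_inhabited fp_qop_bij fp_qopD fp_qopxx.

Definition fp_in1 (x : X1) : free_product := \pi_free_product (FP1 x).
Definition fp_in2 (x : X2) : free_product := \pi_free_product (FP2 x).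

Theorem free_productP : is_free_product fp_in1 fp_in2.
Proof.
have opE s t : \pi_free_product (FPop s t) =
    (\pi_free_product s : free_product) ▷ \pi_free_product t.
  by rewrite -(fp_qopE s t).
split=> [x y|x y|Y f1 f2 f1M f2M].
- by rewrite -opE; apply/fp_piP; apply: fp_rel1.
- by rewrite -opE; apply/fp_piP; apply: fp_rel2.
pose fix ev (t : fp_term) : Y := match t with
  | FP1 x => f1 x
  | FP2 x => f2 x
  | FPop s t => ev s ▷ ev t
  | FPdiv s t => qdiv (ev s) (ev t)
  end.
have evP s t : fp_eq s t -> ev s = ev t.
  elim=> {s t} //=.
  - by move=> s t u _ -> _ ->.
  - by move=> s s' t t' _ -> _ ->.
  - by move=> s s' t t' _ -> _ ->.
  - by move=> s t; rewrite qopK.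
  - by move=> s t; rewrite qdivK.
  - by move=> s t u; apply: qopD.
  - by move=> t; apply: qopxx.
have piE t : ev (repr (\pi_free_product t)) = ev t.
  by apply: evP; apply: fp_reprP.
exists (fun a => ev (repr a)); split; first split.
- by move=> a b; rewrite -{1}[a]reprK -{1}[b]reprK -opE piE.
- by move=> x /=; rewrite piE.
- by move=> x /=; rewrite piE.
- move=> h [hM h1 h2]; apply/funext => a; rewrite -{2}[a]reprK.
  elim: (repr a) => [x|x|s IHs t IHt|s IHs t IHt] /=.
  + by rewrite -h1.
  + by rewrite -h2.
  + by rewrite opE hM IHs IHt.
  + rewrite IHs IHt -(quandle_hom_div hM); congr h.
    apply: (bij_inj (@qop_bij _ (\pi_free_product s : free_product))).
    by rewrite qdivK -opE; apply/fp_piP; apply: fp_sym; apply: fp_divK.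
Qed.

End FreeProduct.

(* Main.v *)
(** A quandle homomorphism cannot increase the rack metric, so it suffices to map
    the free product to a quandle with a function [L] that every translation
    changes by at most 1 but that is unbounded along orbits.  Take the pairs
    [(h, p)] where [h] is an increasing bijection of the line commuting with
    [x |-> x + 1] and [p] is a fixed point of [h], with
    [(h, p) ▷ (k, q) = (h k h^-1, h q)] and [L (h, p) = p].  As [h] fixes
    [p + n] for all integers [n], it moves no point by more than 1.  Let [alpha]
    fix the integers and move every other point to the right, and let [beta] be
    its conjugate by the translation by 1/2.  The constant maps to [(alpha, 0)]
    and [(beta, 1/2)] are homomorphisms, and they extend to the free product;
    [alpha \o beta] moves every point by at least 1/4 to the right, so its
    iterates push the value of [L] to infinity in every component. *)
Require Import Defs.
From HB Require Import structures.
From mathcomp Require Import all_boot.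
From mathcomp Require Import order ssralg ssrnum ssrint rat archimedean.
From mathcomp Require Import lra.
From mathcomp Require Import boolp classical_sets cardinality.

Set Implicit Arguments.
Unset Strict Implicit.
Unset Printing Implicit Defensive.

Import Order.TTheory GRing.Theory Num.Theory.
Local Open Scope ring_scope.
Local Open Scope quandle_scope.

(** * Functions that translations change by at most 1 *)

Lemma qdiv_displacement (X : quandleType) (L : X -> rat) :
  (forall x y : X, `|L (x ▷ y) - L y| <= 1) ->
  forall x y : X, `|L (qdiv x y) - L y| <= 1.
Proof. by move=> LD x y; rewrite distrC -{1}[y](qdivK x). Qed.

Lemma act_displacement (X : quandleType) (L : X -> rat) (s : seq (X * bool)) x :
  (forall x y : X, `|L (x ▷ y) - L y| <= 1) ->
  `|L (act s x) - L x| <= (size s)%:R.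
Proof.
move=> LD; elim: s => [|[z b] s IH] /=; first by rewrite subrr normr0.
rewrite -add1n natrD.
apply: le_trans (ler_distD (L (act s x)) _ _) (lerD _ IH).
by case: b; rewrite /psi /=; [apply: LD | apply: qdiv_displacement].
Qed.

(** * The quandle of pointed lifts *)

Record pointed_lift := PointedLift {
  fwd : rat -> rat;
  bwd : rat -> rat;
  base : rat;
  fwdK : cancel fwd bwd;
  bwdK : cancel bwd fwd;
  fwd_le : {mono fwd : x y / x <= y};
  fwdD1 : forall x, fwd (x + 1) = fwd x + 1;
  fwd_base : fwd base = base
}.

(** The inverse [bwd] is determined by [fwd], and the remaining fields are proofs. *)
Lemma pointed_lift_eq (h k : pointed_lift) :
  fwd h =1 fwd k -> base h = base k -> h = k.
Proof.
case: h k => [f f' p fK f'K fle fD1 fp] [g g' q gK g'K gle gD1 gq] /= /funext fg pq.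
subst g q.
have g'E : f' = g' by apply/funext => x; rewrite -{1}[x]g'K fK.
by subst g'; congr PointedLift; apply: Prop_irrelevance.
Qed.

Section PointedLift.
Implicit Types h k : pointed_lift.

Lemma bwd_le h : {mono bwd h : x y / x <= y}.
Proof. by move=> x y; rewrite -(fwd_le h) !bwdK. Qed.

Lemma bwdD1 h x : bwd h (x + 1) = bwd h x + 1.
Proof. by apply: (can_inj (@fwdK h)); rewrite fwdD1 !bwdK. Qed.

Lemma bwd_base h : bwd h (base h) = base h.
Proof. by rewrite -{1}[base h]fwd_base fwdK. Qed.

Definition lift_inv h : pointed_lift :=
  PointedLift (@bwdK h) (@fwdK h) (@bwd_le h) (@bwdD1 h) (bwd_base h).

Lemma lift_conjK h k :
  cancel (fwd h \o fwd k \o bwd h) (fwd h \o bwd k \o bwd h).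
Proof. by move=> x /=; rewrite !fwdK bwdK. Qed.

Lemma lift_conjVK h k :
  cancel (fwd h \o bwd k \o bwd h) (fwd h \o fwd k \o bwd h).
Proof. by move=> x /=; rewrite fwdK !bwdK. Qed.

Lemma lift_conj_le h k : {mono (fwd h \o fwd k \o bwd h) : x y / x <= y}.
Proof. by move=> x y /=; rewrite !fwd_le bwd_le. Qed.

Lemma lift_conjD1 h k x :
  (fwd h \o fwd k \o bwd h) (x + 1) = (fwd h \o fwd k \o bwd h) x + 1.
Proof. by rewrite /= bwdD1 !fwdD1. Qed.

Lemma lift_conj_base h k :
  (fwd h \o fwd k \o bwd h) (fwd h (base k)) = fwd h (base k).
Proof. by rewrite /= fwdK fwd_base. Qed.

Definition lift_op h k : pointed_lift :=
  PointedLift (@lift_conjK h k) (@lift_conjVK h k) (@lift_conj_le h k)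
    (@lift_conjD1 h k) (lift_conj_base h k).

Lemma lift_op_bij h : bijective (lift_op h).
Proof.
exists (lift_op (lift_inv h)) => k; apply: pointed_lift_eq => [x|] /=;
  by rewrite ?fwdK ?bwdK.
Qed.

Lemma lift_opD h k l :
  lift_op h (lift_op k l) = lift_op (lift_op h k) (lift_op h l).
Proof. by apply: pointed_lift_eq => [x|] /=; rewrite !fwdK. Qed.

Lemma lift_opxx h : lift_op h h = h.
Proof. by apply: pointed_lift_eq => [x|] /=; rewrite ?bwdK ?fwd_base. Qed.

Lemma fwdDz h x (n : int) : fwd h (x + n%:~R) = fwd h x + n%:~R.
Proof.
elim: n => [|n IH|n IH]; first by rewrite !addr0.
  by rewrite -addn1 PoszD intrD !addrA fwdD1 IH.
apply: (addIr 1); rewrite -fwdD1 -!addrA.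
have -> : (- n.+1%:Z)%:~R + 1 = (- n%:Z)%:~R :> rat.
  by rewrite -addn1 PoszD opprD intrD subrK.
exact: IH.
Qed.

Lemma fwd_displacement h x : `|fwd h x - x| <= 1.
Proof.
have := floor_itv (x - base h).
(* The points [base h + n] and [base h + n + 1] enclose [x] and are fixed by [h]. *)
set n := Num.floor _ => /andP[].
rewrite intrD => nx xn.
have lo : fwd h (base h + n%:~R) <= fwd h x by rewrite fwd_le; lra.
have hi : fwd h x <= fwd h (base h + (n + 1)%:~R) by rewrite fwd_le intrD; lra.
move: lo hi; rewrite !fwdDz fwd_base intrD => lo hi.
by rewrite ler_norml; apply/andP; split; lra.
Qed.

End PointedLift.

(** * The piecewise linear map [alpha] *)

(* On [n, n + 1], the graph joins (n, n), (n + 1/3, n + 2/3), (n + 1, n + 1). *)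
Definition alpha_fwd (x : rat) : rat :=
  let n := (Num.floor x)%:~R in
  n + Num.min (2 * (x - n)) ((x - n + 1) / 2).

(** On each unit interval [alpha_fwd] is concave, hence a minimum of linear pieces; its inverse is
    convex, hence a maximum. *)
Definition alpha_bwd (x : rat) : rat :=
  let n := (Num.floor x)%:~R in
  n + Num.max ((x - n) / 2) (2 * (x - n) - 1).

(** Eliminates the floor, leaving linear cases for [lra]. The right end, whose floor is [n + 1], is
    included because the formulas of adjacent intervals agree there. *)
Lemma alpha_fwdE (n : int) x : n%:~R <= x <= n%:~R + 1 ->
  (x <= n%:~R + 1 / 3 /\ alpha_fwd x = 2 * x - n%:~R) \/
  (n%:~R + 1 / 3 <= x /\ alpha_fwd x = (x + n%:~R + 1) / 2).
Proof.
case/andP=> nx; rewrite le_eqVlt => /predU1P[->|xn].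
  rewrite /alpha_fwd (_ : Num.floor _ = n + 1).
    by rewrite intrD /Order.min; case: ltP => ?; lra.
  by apply: floor_def; rewrite !intrD; lra.
rewrite /alpha_fwd (_ : Num.floor x = n).
  by rewrite /Order.min; case: ltP => ?; lra.
by apply: floor_def; rewrite intrD nx.
Qed.

Lemma alpha_bwdE (n : int) x : n%:~R <= x <= n%:~R + 1 ->
  (x <= n%:~R + 2 / 3 /\ alpha_bwd x = (x + n%:~R) / 2) \/
  (n%:~R + 2 / 3 <= x /\ alpha_bwd x = 2 * x - n%:~R - 1).
Proof.
case/andP=> nx; rewrite le_eqVlt => /predU1P[->|xn].
  rewrite /alpha_bwd (_ : Num.floor _ = n + 1).
    by rewrite intrD /Order.max; case: ltP => ?; lra.
  by apply: floor_def; rewrite !intrD; lra.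
rewrite /alpha_bwd (_ : Num.floor x = n).
  by rewrite /Order.max; case: ltP => ?; lra.
by apply: floor_def; rewrite intrD nx.
Qed.

Lemma floorW (x : rat) : exists n : int, n%:~R <= x <= n%:~R + 1.
Proof.
exists (Num.floor x); have /andP[-> /ltW] := floor_itv x.
by rewrite intrD.
Qed.

Lemma alpha_fwdK : cancel alpha_fwd alpha_bwd.
Proof.
move=> x; have [n nx] := floorW x.
by case: (alpha_fwdE nx) => -[? ?]; case: (@alpha_bwdE n (alpha_fwd x)); lra.
Qed.

Lemma alpha_bwdK : cancel alpha_bwd alpha_fwd.
Proof.
move=> x; have [n nx] := floorW x.
by case: (alpha_bwdE nx) => -[? ?]; case: (@alpha_fwdE n (alpha_bwd x)); lra.
Qed.

Lemma alpha_fwdD1 x : alpha_fwd (x + 1) = alpha_fwd x + 1.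
Proof.
have [n nx] := floorW x; have := @alpha_fwdE (n + 1) (x + 1).
by rewrite intrD; case: (alpha_fwdE nx) => -[? ->] []; lra.
Qed.

Lemma alpha_fwd_ge x : x <= alpha_fwd x.
Proof.
by have [n nx] := floorW x; case: (alpha_fwdE nx) => -[? ->]; lra.
Qed.

Lemma alpha_fwd_le : {mono alpha_fwd : x y / x <= y}.
Proof.
apply: le_mono => x y xy; have [n nx] := floorW x.
have [yn|ny] := leP y (n%:~R + 1).
  by case: (alpha_fwdE nx) => -[? ->]; case: (@alpha_fwdE n y); lra.
(* The image of [x] stays below [n + 1], or equals it, while [y] lies beyond and is not moved to the
   left. *)
apply: le_lt_trans (lt_le_trans ny (alpha_fwd_ge y)).
by case: (alpha_fwdE nx) => -[? ->]; lra.
Qed.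

Lemma alpha_fwd0 : alpha_fwd 0 = 0.
Proof. by case: (@alpha_fwdE 0 0); lra. Qed.

Definition alpha : pointed_lift :=
  PointedLift alpha_fwdK alpha_bwdK alpha_fwd_le alpha_fwdD1 alpha_fwd0.

HB.instance Definition _ := isQuandle.Build pointed_lift
  (inhabits alpha) lift_op_bij lift_opD lift_opxx.

(** * Conjugation by a translation of the line *)

Section Shift.
Variables (h : pointed_lift) (c : rat).

Let sfwd x := fwd h (x - c) + c.
Let sbwd x := bwd h (x - c) + c.

Fact shift_fwdK : cancel sfwd sbwd.
Proof. by move=> x; rewrite /sfwd /sbwd addrK fwdK subrK. Qed.

Fact shift_bwdK : cancel sbwd sfwd.
Proof. by move=> x; rewrite /sfwd /sbwd addrK bwdK subrK. Qed.

Fact shift_le : {mono sfwd : x y / x <= y}.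
Proof. by move=> x y; rewrite lerD2r fwd_le lerD2r. Qed.

Fact shiftD1 x : sfwd (x + 1) = sfwd x + 1.
Proof. by rewrite /sfwd addrAC fwdD1 addrAC. Qed.

Fact shift_base : sfwd (base h + c) = base h + c.
Proof. by rewrite /sfwd addrK fwd_base. Qed.

Definition lift_shift : pointed_lift :=
  PointedLift shift_fwdK shift_bwdK shift_le shiftD1 shift_base.

End Shift.

Definition beta : pointed_lift := lift_shift alpha (1 / 2).

(** Where [beta] moves a point by less than 1/4, [alpha] makes up the difference. The constant is
    sharp: equality holds on [n + 1/2, n + 3/4]. *)
Lemma alpha_beta_ge x : x + 1 / 4 <= fwd alpha (fwd beta x).
Proof.
rewrite /=; have [n nx] := floorW x.
have [xn|nx2] := leP x (n%:~R + 1 / 2).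
  have := @alpha_fwdE (n - 1) (x - 1 / 2); rewrite intrB.
  case=> [|[? ?]|[? ?]]; first lra.
    by case: (@alpha_fwdE n (alpha_fwd (x - 1 / 2) + 1 / 2)); lra.
  by case: (@alpha_fwdE n (alpha_fwd (x - 1 / 2) + 1 / 2)); lra.
case: (@alpha_fwdE n (x - 1 / 2)) => [|[y13 yE]|[y13 yE]]; first lra.
  have [yn|ny] := leP (alpha_fwd (x - 1 / 2) + 1 / 2) (n%:~R + 1).
    by case: (@alpha_fwdE n (alpha_fwd (x - 1 / 2) + 1 / 2)); lra.
  (* Here and in the last case [beta] alone moves [x] by at least 1/4. *)
  by apply: le_trans (alpha_fwd_ge _); lra.
by apply: le_trans (alpha_fwd_ge _); lra.
Qed.

Theorem proposition3p14 (X1 X2 : quandleType)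
  (fin1 : finite_set (components X1)) (fin2 : finite_set (components X2))
  (inj1 : injective (env_gen X1)) (inj2 : injective (env_gen X2))
  (P : quandleType) (i1 : X1 -> P) (i2 : X2 -> P)
  (coprod : is_free_product i1 i2)
  (C : set P) (hC : components P C) :
  infinite_diameter C.
Proof.
case: coprod => _ _ /(_ pointed_lift (fun=> alpha) (fun=> beta)) [||f [[fM f1 f2] _]].
- by move=> x y; rewrite qopxx.
- by move=> x y; rewrite qopxx.
have [x1] := @quandle_inhabited X1; have [x2] := @quandle_inhabited X2.
pose L p := base (f p).
have LD (p q : P) : `|L (p ▷ q) - L q| <= 1.
  by rewrite /L fM; apply: fwd_displacement.
case: hC => p _ <- N.
pose w k := flatten (nseq k [:: (i1 x1, true); (i2 x2, true)]).
have Lw k : L p + k%:R / 4 <= L (act (w k) p).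
  elim: k => [|k IH]; first by rewrite mul0r addr0.
  rewrite /= /psi /= {2}/L !fM [f (i1 x1)]f1 [f (i2 x2)]f2.
  apply: le_trans (alpha_beta_ge _); move: IH; rewrite /L -natr1; lra.
(* Each round gains at least 1/4, so [4 * N] rounds gain at least [N]. *)
have pw : component p (act (w (4 * N)) p).
  by apply/componentP; exists (size (w (4 * N))), (w (4 * N)).
exists p, (act (w (4 * N)) p); split=> //.
  by apply/componentP; exists 0, [::].
(* Both points lie in one component, so the distance is the length of an actual word [s] and not the
   default 0. *)
have [[s [<- ws]] _] := rack_distP pw.
rewrite -(ler_nat rat); apply: le_trans (act_displacement s p LD); rewrite -ws.
apply: le_trans (ler_norm _); have := Lw (4 * N)%N; rewrite natrM; lra.
Qed.
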